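(* Let $R$ be a semiring, $V$ an $R$-module, and let $(A_1,\dots,A_n)$ and $(W_1,\dots,W_n)$ be $n$-tuples of submodules of $V$ such that $W_k\subset A_k$ and $W_k$ is summand absorbing in $A_k$ for $k=1,\dots,n$, and $W_i\cap A_j\subset W_j$ (whence $W_i\cap A_j=W_i\cap W_j$) for any two different $i,j\in\{1,\dots,n\}$. If $(A_1,\dots,A_n)$ has amalgamation in $V$, then $(W_1,\dots,W_n)$ also has amalgamation in $V$.
   Context: $R$ is a semiring with $0$ and $1$, and $R$-module means left $R$-(semi)module; no subtraction is assumed. For submodules $W\subset A$ of $V$, $W$ is summand absorbing (SA) in $A$ if for all $x,y\in A$, $x+y\in W$ implies $x\in W$ and $y\in W$. Exchange equivalence. Let $A_1,\dots,A_n$ be submodules of $V$. A basic exchange in $A_1\times\cdots\times A_n$ is a pair of tuples $(a_1,\dots,a_n),(a'_1,\dots,a'_n)\in A_1\times\cdots\times A_n$ for which there are $i\ne j$ and $d\in A_i\cap A_j$ with $a_i=a'_i+d$, $a'_j=a_j+d$, and $a_k=a'_k$ for $k\ne i,j$. Two tuples are exchange equivalent in $A_1\times\cdots\times A_n$ if they are connected by a finite chain of tuples in $A_1\times\cdots\times A_n$ in which any two consecutive members form, in one order or the other, a basic exchange. Exchange equivalent tuples have the same sum in $V$. The tuple $(A_1,\dots,A_n)$ has amalgamation in $V$ if any two tuples $(a_1,\dots,a_n),(b_1,\dots,b_n)\in A_1\times\cdots\times A_n$ with $a_1+\cdots+a_n=b_1+\cdots+b_n$ are exchange equivalent in $A_1\times\cdots\times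 A_n$. *)

(* Defs.v *)
From Stdlib Require Export Relation_Operators.
From mathcomp Require Export all_boot all_algebra.
From mathcomp Require Export classical_sets.

Set Implicit Arguments.
Unset Strict Implicit.
Unset Printing Implicit Defensive.

Import GRing.Theory.
Local Open Scope ring_scope.
Local Open Scope classical_set_scope.

(* Subsets are [set V], so that submodules need not be decidable. *)
Definition submodule (R : pzSemiRingType) (V : lSemiModType R) (W : set V) :
  Prop := GRing.subsemimod_closed [in W].

Definition summand_absorbing (V : nmodType) (A W : set V) : Prop :=
  forall x y : V, A x -> A y -> W (x + y) -> W x /\ W y.

Section Exchange.
Variables (V : nmodType) (n : nat) (A : 'I_n -> set V).

Definition tuple_in (a : {ffun 'I_n -> V}) : Prop := forall k, A k (a k).

Definition basic_exchange (a a' : {ffun 'I_n -> V}) : Prop :=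
  [/\ tuple_in a, tuple_in a' &
    exists i j : 'I_n, exists d : V,
      [/\ i != j, (A i `&` A j) d, a i = a' i + d, a' j = a j + d &
          forall k, k != i -> k != j -> a k = a' k]].

(* Membership of both ends is required separately, because the reflexive case
   of the closure (a chain of length zero) does not enforce it. *)
Definition exchange_equivalent (a b : {ffun 'I_n -> V}) : Prop :=
  [/\ tuple_in a, tuple_in b &
    clos_refl_trans {ffun 'I_n -> V}
      (fun u v => basic_exchange u v \/ basic_exchange v u) a b].

Definition amalgamation : Prop :=
  forall a b : {ffun 'I_n -> V}, tuple_in a -> tuple_in b ->
    \sum_(k < n) a k = \sum_(k < n) b k -> exchange_equivalent a b.

End Exchange.

(* Main.v *)
(** A single exchange starting from a tuple in the [W k] stays there: summand
    absorption puts the exchanged element [d] in [W i], the condition on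
    intersections then puts it in [W j], and [W j] is closed under addition.
    So any exchange chain in the [A k] starting in the [W k] is already an
    exchange chain in the [W k]. *)

From Stdlib Require Import Operators_Properties.
Require Import Defs.

Local Open Scope ring_scope.
Local Open Scope classical_set_scope.

Lemma submoduleD (R : pzSemiRingType) (V : lSemiModType R) (W : set V) (x y : V) :
  submodule W -> W x -> W y -> W (x + y).
Proof. by case=> -[_ addW] _ /mem_set Wx /mem_set Wy; apply/set_mem/addW. Qed.

(** Moving [d] back from position [j] to position [i] undoes the exchange. *)
Lemma basic_exchange_sym (V : nmodType) (n : nat) (A : 'I_n -> set V)
    (a b : {ffun 'I_n -> V}) :
  basic_exchange A a b -> basic_exchange A b a.
Proof.
case=> Aa Ab [i [j [d [neq_ij [Aid Ajd] ai bj eq_ab]]]].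
split=> //; exists j, i, d; split=> //; first by rewrite eq_sym.
by move=> k kj ki; rewrite eq_ab.
Qed.

Lemma basic_exchange_restrict (R : pzSemiRingType) (V : lSemiModType R) (n : nat)
    (A W : 'I_n -> set V) (a b : {ffun 'I_n -> V})
    (submodW : forall k : 'I_n, submodule (W k))
    (saW : forall k : 'I_n, summand_absorbing (A k) (W k))
    (capWA : forall i j : 'I_n, i != j -> W i `&` A j `<=` W j) :
  tuple_in W a -> basic_exchange A a b -> basic_exchange W a b.
Proof.
move=> Wa [Aa Ab [i [j [d [neq_ij [Aid Ajd] ai bj eq_ab]]]]].
have [Wbi Wid] : W i (b i) /\ W i d by apply: saW; rewrite -?ai.
have Wjd : W j d by apply: (capWA i j).
split=> //; last by exists i, j, d.
move=> k; have [->//|ki] := eqVneq k i; have [->|kj] := eqVneq k j.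
  by rewrite bj; apply: submoduleD.
by rewrite -eq_ab.
Qed.

Theorem theorem4p5 (R : pzSemiRingType) (V : lSemiModType R) (n : nat)
    (A W : 'I_n -> set V)
    (submodA : forall k : 'I_n, submodule (A k))
    (submodW : forall k : 'I_n, submodule (W k))
    (subWA : forall k : 'I_n, W k `<=` A k)
    (saW : forall k : 'I_n, summand_absorbing (A k) (W k))
    (capWA : forall i j : 'I_n, i != j -> W i `&` A j `<=` W j) :
  amalgamation A -> amalgamation W.
Proof.
move=> amA a b Wa Wb eq_sum; split=> //.
have inA c : tuple_in W c -> tuple_in A c by move=> Wc k; apply: subWA.
have [_ _ chain] := amA a b (inA a Wa) (inA b Wb) eq_sum.
(* [clos_rt_rt1n] peels exchanges off the front of the chain, so membership in the [W k], kept
   general in the induction, passes from each tuple to the next. *)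
elim: {chain}(clos_rt_rt1n _ _ _ _ chain) Wa {Wb eq_sum} => [c|u v w step _ IH] Wu; first exact: rt_refl.
have Wuv : basic_exchange W u v.
  apply: (basic_exchange_restrict R V n A) => //.
  (* A link may point either way; symmetry orients it to start at [u], the end already known to lie
     in the [W k]. *)
  by case: step => // /basic_exchange_sym.
apply: (rt_trans _ _ _ v); first by apply: rt_step; left.
by apply: IH; case: Wuv.
Qed.
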